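(* Let $T$ be a regular $s$-interval exchange transformation on $[\ell,r[$. For every semi-interval $I=[u,v[$ admissible for $T$, the transformation $S$ induced by $T$ on $I$ is a regular $s$-interval exchange transformation whose set of separation points is $\mathrm{Sep}(S)=\mathrm{Div}(I,T)\cap I$.
   Context: Let $A$ be a finite alphabet of cardinality $s$ with two total orders $<_1,<_2$; write $A=\{a_1,\dots,a_s\}$ with $a_1<_1\cdots<_1a_s$. A semi-interval is $[\alpha,\beta[=\{z:\alpha\le z<\beta\}$. An $s$-interval exchange transformation $T$ on $[\ell,r[$ is given by a partition $(I_a)_{a\in A}$ of $[\ell,r[$ into semi-intervals $I_a=[\gamma_a,\mu_a[$ of lengths $\lambda_a>0$ placed left to right in the order $<_1$; with $\nu_a=\ell+\sum_{b\le_2a}\lambda_b$, $T(z)=z+\nu_a-\mu_a$ for $z\in I_a$. Write $\gamma_i=\gamma_{a_i}$; the set of separation points is $\mathrm{Sep}(T)=\{\gamma_1=\ell,\gamma_2,\dots,\gamma_s\}$ (the left endpoints of the exchanged semi-intervals). $T$ is regular if the orbits $\{T^n(\gamma_i):n\in\mathbb Z\}$, $2\le i\le s$, are infinite and pairwise disjoint; regular implies minimal (all orbits dense). For minimal $T$ and a semi-interval $I\subset[\ell,r[$, the transformation induced by $T$ on $I$ is the first return map $S:I\to I$, $S(z)=T^n(z)$ with $n=\min\{n>0:T^n(z)\in I\}$. Admissibility: for $I=[u,v[\subset[\ell,r[$ and $z\in[\ell,r[$ let $\rho^+_{I,T}(z)=\min\{n>0:T^n(z)\in\,]u,v[\}$,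 $\rho^-_{I,T}(z)=\min\{n\ge0:T^{-n}(z)\in\,]u,v[\}$, $E_{I,T}(z)=\{k\in\mathbb Z:-\rho^-_{I,T}(z)\le k<\rho^+_{I,T}(z)\}$, $N_{I,T}(z)=\{T^k(z):k\in E_{I,T}(z)\}$, $\mathrm{Div}(I,T)=\bigcup_{i=1}^sN_{I,T}(\gamma_i)$. $I=[u,v[$ with $\ell\le u<v\le r$ is admissible for $T$ if $u,v\in\mathrm{Div}(I,T)\cup\{r\}$. *)

(* Defs.v *)
From HB Require Import structures.
From mathcomp Require Import all_boot all_order all_algebra.
From mathcomp Require Import all_classical all_reals.

Set Implicit Arguments.
Unset Strict Implicit.
Unset Printing Implicit Defensive.

Import Order.TTheory GRing.Theory Num.Theory.
Local Open Scope classical_set_scope.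
Local Open Scope ring_scope.

(* Non-strict total order; reflexivity follows from totality. *)
Definition total_order (A : Type) (le : rel A) : Prop :=
  [/\ total le, antisymmetric le & transitive le].

(* An #|A|-interval exchange transformation on [lend, rend[.  The fields [le1]
   and [le2] are the non-strict versions of the two orders of the alphabet. *)
Record iet (R : realType) (A : finType) := Iet {
  le1 : rel A;
  le2 : rel A;
  le1_order : total_order le1;
  le2_order : total_order le2;
  lend : R;
  len : A -> R;
  len_gt0 : forall a, 0 < len a }.

Section Iet.
Context {R : realType} {A : finType}.
Variable T : iet R A.

Definition rend : R := lend T + \sum_(a : A) len T a.

Definition lt1 : rel A := fun a b => (a != b) && le1 T a b.

Definition gamma (a : A) : R := lend T + \sum_(b | lt1 b a) len T b.
Definition mu (a : A) : R := gamma a + len T a.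
Definition nu (a : A) : R := lend T + \sum_(b | le2 T b a) len T b.

(* Extended by the identity outside [lend, rend[. *)
Definition iet_map (z : R) : R :=
  if [pick a | z \in `[gamma a, mu a[] is Some a then z + nu a - mu a else z.

(* The inverse of the bijection [iet_map] of [lend, rend[; its values at other
   points are irrelevant. *)
Definition iet_inv : R -> R := 'pinv_id `[lend T, rend[%classic iet_map.

Definition iet_pow (k : int) (z : R) : R :=
  match k with
  | Posz n => iter n iet_map z
  | Negz n => iter n.+1 iet_inv z
  end.

Definition orbit (z : R) : set R := range (iet_pow^~ z).

Definition Sep : set R := range gamma.

(* All letters except the smallest one for the first order: those denoted
   a_2, ..., a_s. *)
Definition not_first : set A := [set a | exists b, lt1 b a].

Definition regular : Prop :=
  (forall a, not_first a -> infinite_set (orbit (gamma a))) /\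
  trivIset not_first (fun a => orbit (gamma a)).

End Iet.

Coercion iet_map : iet >-> Funclass.

(* The least element of a set of natural numbers; [None] stands for the value
   +oo of the minimum of the empty set. *)
Definition min_nat (P : set nat) : option nat :=
  match pselect (exists n, `[< P n >]) with
  | left exP => Some (ex_minn exP)
  | right _ => None
  end.

(* First return map of [f] to [I], undefined at the points of no return. *)
Definition induced (R : realType) (f : R -> R) (I : set R) (z : R) : option R :=
  omap (fun n => iter n f z) (min_nat [set n | (0 < n)%N /\ I (iter n f z)]).

Section Admissible.
Context {R : realType} {A : finType}.
Variables (u v : R) (T : iet R A).

Definition rho_plus (z : R) : option nat :=
  min_nat [set n | (0 < n)%N /\ iet_pow T n%:Z z \in `]u, v[].

Definition rho_minus (z : R) : option nat :=
  min_nat [set n | iet_pow T (- n%:Z) z \in `]u, v[].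

Definition E_set (z : R) : set int :=
  [set k | (if rho_minus z is Some n then - n%:Z <= k else True) /\
           (if rho_plus z is Some n then k < n%:Z else True)].

Definition N_set (z : R) : set R := [set iet_pow T k z | k in E_set z].

Definition Div : set R := \bigcup_(a : A) N_set (gamma T a).

Definition admissible : Prop :=
  [/\ lend T <= u, u < v, v <= rend T,
      (Div `|` [set rend T]) u & (Div `|` [set rend T]) v].

End Admissible.

(* Main.v *)
Require Import Defs.
From HB Require Import structures.
From mathcomp Require Import all_boot all_order all_algebra.
From mathcomp Require Import all_classical all_reals.
From mathcomp Require Import zify lra.

Set Implicit Arguments.
Unset Strict Implicit.
Unset Printing Implicit Defensive.

Import Order.TTheory GRing.Theory Num.Theory.
Local Open Scope classical_set_scope.
Local Open Scope ring_scope.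

(* Cut [u, v[ at the points d of ]u, v[ whose forward orbit meets u, v or a
   separation point of T before it returns to ]u, v[.  Between two consecutive
   cuts the iterates of T are translations up to the first return to [u, v[,
   which exists because the disjoint images of an interval cannot all fit in
   [lend T, rend T[.  Hence T and its inverse return to [u, v[ in bounded time,
   so that the union X of the iterates of [u, v[ is T-invariant with finitely
   many boundary points.  Following the orbit of a boundary point in both
   directions exhibits a periodic point or a connection gamma_a = T^n gamma_b
   with n > 0; regularity excludes both, so X is everything: T is minimal.
   Each gamma_a with a not the first letter thus has a first backward visit
   x_a in ]u, v[.  By admissibility these are the only cuts, and together with
   u (for the first letter) they are the s separation points of the induced
   map; an orbit of the latter is contained in an orbit of T. *)

(** * Disjoint semi-intervals *)

Section SemiIntervals.
Context {R : realType} {I : finType}.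
Variables (p l : I -> R).
Hypothesis l_gt0 : forall i, 0 < l i.

(** Disjointness of the semi-intervals from [p i] to [p i + l i], put as linear inequalities. *)
Definition apart := forall i j, i != j -> p i + l i <= p j \/ p j + l j <= p i.

Let card_predD1_lt (P : pred I) i :
  P i -> (#|[pred j | P j && (j != i)]| < #|P|)%N.
Proof.
move=> Pi; apply/proper_card/properP; split.
  by apply/fintype.subsetP => j /andP[].
by exists i => //; rewrite !inE eqxx andbF.
Qed.

(** Induction on the number of semi-intervals: remove the rightmost one; all others end no later
    than it begins. *)
Lemma apart_packing (P : pred I) (u w : R) : u <= w -> apart ->
  (forall i, P i -> u <= p i /\ p i + l i <= w) ->
  \sum_(i | P i) l i <= w - u.
Proof.
move=> + apt; have [n] := ubnP #|P|; elim: n P w => // n IHn P w Pn uw Pin.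
have [i0 Pi0|P0] := pickP P; last by rewrite big_pred0// subr_ge0.
case: (@arg_maxP _ _ _ i0 P p Pi0) => m Pm mmax.
rewrite (bigD1 m)//=.
have [um mw] := Pin m Pm.
have : \sum_(i | P i && (i != m)) l i <= p m - u.
  apply: IHn => //.
    exact: leq_trans (card_predD1_lt Pm) Pn.
  move=> i /andP[Pi im]; have [ui iw] := Pin i Pi; split=> //.
  have [//|mi] := apt _ _ im.
  by have := mmax i Pi; have := l_gt0 m; rewrite /=; lra.
by move=> ?; lra.
Qed.

(** Induction on the number of semi-intervals: remove one that contains [u]; the others cover what
    lies to the right of its end. *)
Lemma covering_length (P : pred I) (u w : R) :
  (forall z, u <= z < w -> exists2 i, P i & p i <= z < p i + l i) ->
  w - u <= \sum_(i | P i) l i.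
Proof.
have [n] := ubnP #|P|; elim: n P u => // n IHn P u Pn cov.
have [wu|uw] := leP w u.
  by rewrite (@le_trans _ _ 0) ?subr_le0// sumr_ge0// => i _; exact: ltW.
have [|i Pi /andP[iu ui]] := cov u; first by rewrite lexx.
rewrite (bigD1 i)//=.
have : w - (p i + l i) <= \sum_(j | P j && (j != i)) l j.
  apply: IHn => [|z /andP[iz zw]].
    exact: leq_trans (card_predD1_lt Pi) Pn.
  have [|j Pj /andP[jz zj]] := cov z; first by rewrite zw (le_trans (ltW ui)).
  exists j; last by rewrite jz.
  by rewrite Pj/=; apply/eqP => ji; move: zj; rewrite ji ltNge iz.
by move=> ?; lra.
Qed.

Section Tiling.
Variables u w : R.
Hypotheses (apt : apart) (inside : forall i, u <= p i /\ p i + l i <= w).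
Hypothesis total : \sum_i l i = w - u.

(** The packing bounds to the left and to the right of [a] add up to exactly the total length, so
    both are equalities. *)
Lemma tiling_start a : p a = u + \sum_(b | p b < p a) l b.
Proof.
have [ua aw] := inside a; have la := l_gt0 a.
have le1 : \sum_(b | p b < p a) l b <= p a - u.
  apply: apart_packing => // b ba; have [ub bw] := inside b; split=> //.
  have [|//|ab] := @apt b a; first by apply: contraTneq ba => ->; rewrite ltxx.
  by have := l_gt0 a; lra.
have le2 : \sum_(b | ~~ (p b < p a) && (b != a)) l b <= w - (p a + l a).
  apply: apart_packing => // b /andP[ab ba]; have [ub bw] := inside b; split=> //.
  have [ba'|//] := @apt b a ba; have := l_gt0 b; lra.
have := total; rewrite (bigID (fun b => p b < p a))/=.
by rewrite [X in _ + X](bigD1 a) ?ltxx//=; lra.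
Qed.

(** Packing on both sides of an uncovered [z] leaves a gap up to [q], the next left endpoint or [w],
    so the lengths would not fill the interval. *)
Lemma tiling_cover z : u <= z < w -> exists a, p a <= z < p a + l a.
Proof.
move=> /andP[uz zw]; apply: contrapT => ncov.
have nc a : ~~ (p a <= z < p a + l a) by apply/negP => ?; apply: ncov; exists a.
have le1 : \sum_(b | p b <= z) l b <= z - u.
  apply: apart_packing => // b bz; have [ub bw] := inside b; split=> //.
  by move: (nc b); rewrite bz/= -leNgt.
have [q zq le2] : exists2 q, z < q & \sum_(b | ~~ (p b <= z)) l b <= w - q.
  have [b0 Pb0|P0] := pickP (fun b => ~~ (p b <= z)); last first.
    by exists w => //; rewrite big_pred0// subrr.
  case: (@arg_minP _ _ _ b0 (fun b => ~~ (p b <= z)) p Pb0) => m Pm mmin.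
  exists (p m); first by rewrite ltNge.
  apply: apart_packing => // [|b /mmin mb]; last by have [] := inside b.
  by have [] := inside m; have := l_gt0 m; lra.
by have := total; rewrite (bigID (fun b => p b <= z))/=; lra.
Qed.

End Tiling.
End SemiIntervals.

(** * Interval exchanges and their inverses *)

Section Exchange.
Context {R : realType} {A : finType}.
Implicit Types (T : iet R A) (a b : A) (z w : R).

(** Exchanging the two orders gives the inverse map on the domain, so each result on forward
    iterates also serves for backward ones. *)
Definition swap T : iet R A :=
  Iet (le2_order T) (le1_order T) (lend T) (len_gt0 T).

Lemma swap_swap T : swap (swap T) = T. Proof. by case: T. Qed.

Definition dom T z := lend T <= z < rend T.

Lemma le1xx T a : le1 T a a.
Proof. by have [tot _ _] := le1_order T; have /orP[] := tot a a. Qed.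

Lemma muE T a : mu T a = lend T + \sum_(b | le1 T b a) len T b.
Proof.
rewrite /mu /gamma -addrA; congr (_ + _).
by rewrite [RHS](bigD1 a) ?le1xx//= addrC; congr (_ + _); apply: eq_bigl => b; rewrite andbC.
Qed.

Lemma nuE T a : nu T a = mu (swap T) a.
Proof. by rewrite muE. Qed.

Lemma sum_len_subset T (P Q : pred A) : (forall a, P a -> Q a) ->
  \sum_(a | P a) len T a <= \sum_(a | Q a) len T a.
Proof.
move=> PQ; rewrite [leRHS](bigID P)/= [X in X + _](eq_bigl P).
  by rewrite lerDl sumr_ge0// => a _; exact: ltW (len_gt0 T a).
by move=> a; rewrite andb_idl//; exact: PQ.
Qed.

Lemma mu_le_gamma T a b : lt1 T a b -> mu T a <= gamma T b.
Proof.
have [tot asym tr] := le1_order T.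
move=> /andP[ab leab]; rewrite muE lerD2l; apply: sum_len_subset => c ca.
rewrite /lt1 (tr _ _ _ ca leab) andbT; apply: contra ab => /eqP cb.
by apply/eqP/asym; rewrite leab -cb.
Qed.

Lemma lt1_total T a b : a != b -> lt1 T a b \/ lt1 T b a.
Proof.
have [tot _ _] := le1_order T; rewrite /lt1 [b == a]eq_sym => ->/=.
by have /orP[] := tot a b; [left|right].
Qed.

Lemma gamma_lt_mu T a : gamma T a < mu T a.
Proof. by rewrite ltrDl len_gt0. Qed.

Lemma gamma_apart T : apart (gamma T) (len T).
Proof.
by move=> a b /(lt1_total T)[]/mu_le_gamma; [left|right].
Qed.

Lemma lend_le_gamma T a : lend T <= gamma T a.
Proof. by rewrite lerDl sumr_ge0// => b _; exact: ltW (len_gt0 T b). Qed.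

Lemma mu_le_rend T a : mu T a <= rend T.
Proof. by rewrite muE lerD2l; exact: sum_len_subset. Qed.

Lemma dom_gamma T a : dom T (gamma T a).
Proof.
by rewrite /dom lend_le_gamma (lt_le_trans (gamma_lt_mu T a))// mu_le_rend.
Qed.

Lemma in_exchanged T z : dom T z -> exists a, gamma T a <= z < mu T a.
Proof.
apply: tiling_cover; first exact: len_gt0.
- exact: gamma_apart.
- by move=> a; split; [exact: lend_le_gamma|exact: mu_le_rend].
- by rewrite /rend; lra.
Qed.

Lemma exchanged_dom T a z : gamma T a <= z < mu T a -> dom T z.
Proof.
move=> /andP[az za]; rewrite /dom (le_trans (lend_le_gamma T a) az)/=.
exact: lt_le_trans za (mu_le_rend T a).
Qed.

Lemma exchanged_uniq T a b z : gamma T a <= z < mu T a ->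
  gamma T b <= z < mu T b -> a = b.
Proof.
move=> /andP[az za] /andP[bz zb]; apply/eqP; apply: contraT => /(gamma_apart T).
by rewrite -!/(mu _ _) => -[?|?]; lra.
Qed.

(** A semi-interval and its image have the same length, so the translation is also the difference of
    their left endpoints; those of the images belong to [swap T]. *)
Lemma iet_mapE T a z : gamma T a <= z < mu T a ->
  T z = z + (gamma (swap T) a - gamma T a).
Proof.
move=> az; rewrite /iet_map; case: pickP => [b|/(_ a)]; rewrite in_itv/= ?az//.
move=> /(exchanged_uniq az) <-; rewrite nuE /mu /=; lra.
Qed.

Lemma iet_map_in T a z : gamma T a <= z < mu T a ->
  gamma (swap T) a <= T z < mu (swap T) a.
Proof. by move=> az; rewrite (iet_mapE az); move: az; rewrite /mu/=; lra. Qed.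

Lemma iet_map_gamma T a : T (gamma T a) = gamma (swap T) a.
Proof. by rewrite (@iet_mapE T a) ?lexx ?gamma_lt_mu//; lra. Qed.

Lemma dom_swap T z : dom (swap T) z = dom T z. Proof. by []. Qed.

Lemma dom_map T z : dom T z -> dom T (T z).
Proof. by move=> /in_exchanged[a /iet_map_in/exchanged_dom]. Qed.

Lemma swapK T z : dom T z -> swap T (T z) = z.
Proof.
move=> /in_exchanged[a az]; rewrite (iet_mapE (iet_map_in az)) (iet_mapE az).
by rewrite swap_swap; lra.
Qed.

Lemma mapK_swap T z : dom T z -> T (swap T z) = z.
Proof. by move=> dz; have := @swapK (swap T) z dz; rewrite swap_swap. Qed.

Lemma dom_iter T n z : dom T z -> dom T (iter n T z).
Proof. by move=> dz; elim: n => //= n; exact: dom_map. Qed.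

Lemma iter_swapK T n z : dom T z -> iter n (swap T) (iter n T z) = z.
Proof.
move=> dz; elim: n => // n IHn; rewrite iterSr iterS swapK//; exact: dom_iter.
Qed.

Lemma iterK_swap T n z : dom T z -> iter n T (iter n (swap T) z) = z.
Proof. by move=> dz; have := @iter_swapK (swap T) n z dz; rewrite swap_swap. Qed.

Lemma iter_inj T n z w : dom T z -> dom T w -> iter n T z = iter n T w -> z = w.
Proof. by move=> dz dw e; rewrite -(iter_swapK n dz) e iter_swapK. Qed.

Lemma iter_subn_eq T m n z w : dom T z -> dom T w -> (m <= n)%N ->
  iter m T z = iter n T w -> z = iter (n - m) T w.
Proof.
move=> dz dw mn e; apply: (@iter_inj T m) => //; first exact: dom_iter.
by rewrite e -iterD subnKC.
Qed.

Lemma iet_invE T z : dom T z -> iet_inv T z = swap T z.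
Proof.
move=> dz; have d' : dom T (swap T z) by exact: (@dom_map (swap T)).
rewrite -[in LHS](mapK_swap dz) /iet_inv pinvKV//; last first.
  by rewrite inE/= in_itv.
move=> x y; rewrite !inE/= !in_itv/= => dx dy; exact: (@iter_inj T 1).
Qed.

Lemma iter_iet_inv T n z : dom T z -> iter n (iet_inv T) z = iter n (swap T) z.
Proof.
by move=> dz; elim: n => //= n ->; rewrite iet_invE//; exact: (@dom_iter (swap T)).
Qed.

Lemma iet_pow_neg T n z : dom T z -> iet_pow T (- n%:Z) z = iter n (swap T) z.
Proof. by case: n => // n dz; rewrite -NegzE /iet_pow iter_iet_inv. Qed.

End Exchange.

(** * Return to a semi-interval *)

Section Return.
Context {R : realType} {A : finType}.
Variables (T : iet R A) (u v : R).
Hypotheses (lu : lend T <= u) (vr : v <= rend T).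

Definition cut_targets : seq R := u :: v :: [seq gamma T a | a <- enum A].

(** [d] is the first point of the open interval met on the backward orbit of [t], time 0
    included. *)
Definition cut (t d : R) : Prop :=
  u < d < v /\
  exists2 n, iter n T d = t &
    forall j, (0 < j <= n)%N -> ~~ (u < iter j T d < v).

(** Of two such points, the one farther back would pass through the other on its way to [t]. *)
Lemma cut_uniq t d e : cut t d -> cut t e -> d = e.
Proof.
wlog : d e / exists n m, [/\ (n <= m)%N, iter n T d = t, iter m T e = t,
    u < d < v /\ u < e < v &
    forall j, (0 < j <= m)%N -> ~~ (u < iter j T e < v)].
  move=> H cd ce; have [du [n nd Hd]] := cd; have [eu [m me He]] := ce.
  have [nm|mn] := leqP n m; first by apply: H => //; exists n, m.
  by apply/esym; apply: H => //; exists m, n; split=> //; exact: ltnW.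
move=> [n [m [nm nd me [du eu] H]]] _ _.
have dd : dom T d by move: du lu vr; rewrite /dom; lra.
have de : dom T e by move: eu lu vr; rewrite /dom; lra.
have E : d = iter (m - n) T e by apply: (iter_subn_eq dd de nm); rewrite nd.
have [mn|mn] := posnP (m - n)%N; first by rewrite E mn.
by have := H (m - n)%N; rewrite mn leq_subr -E du => /(_ isT).
Qed.

Section Interval.
Variables p q : R.
Hypotheses (up : u <= p) (pq : p < q) (qv : q <= v).
Hypothesis uncut : forall t d, t \in cut_targets -> cut t d -> ~~ (p < d < q).

(* [lra] ignores section hypotheses. *)
Ltac blra := move: lu vr up pq qv; lra.

Let dom_in z : p <= z < q -> dom T z.
Proof. by move=> ?; rewrite /dom; blra. Qed.

Let rigid n := forall z, p <= z < q -> iter n T z = z + (iter n T p - p).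
Let avoids n := forall z, p <= z < q -> ~~ (u <= iter n T z < v).

Let avoids_open n z j : (forall k, (0 < k <= n)%N -> avoids k) ->
  p <= z < q -> (0 < j <= n)%N -> ~~ (u < iter j T z < v).
Proof.
by move=> av zpq /av /(_ z zpq); apply: contra => /andP[/ltW -> ->].
Qed.

(** If the translated image of the interval overran the exchanged semi-interval containing its left
    end, the preimage of the overrun endpoint would be a cut strictly between [p] and [q]. *)
Let rigid_step n : rigid n -> (forall k, (0 < k <= n)%N -> avoids k) ->
  rigid n.+1.
Proof.
move=> rn av; have ppq : p <= p < q by rewrite lexx.
have [a /andP[ap pa]] := in_exchanged (dom_iter n (dom_in ppq)).
have qa : iter n T p + (q - p) <= mu T a.
  rewrite leNgt; apply/negP => aq; set d := p + (mu T a - iter n T p).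
  have dpq : p < d < q by rewrite /d; blra.
  have dpq' : p <= d < q by blra.
  have Ed : iter n T d = mu T a by rewrite rn// /d; blra.
  have /in_exchanged[b /andP[ba ab]] := dom_iter n (dom_in dpq').
  (* The end of one exchanged semi-interval is the beginning of another, hence a target of cuts. *)
  have Eb : mu T a = gamma T b.
    have : a != b by apply/eqP => eab; move: ab; rewrite -eab Ed ltxx.
    by move=> /(gamma_apart T); rewrite -!/(mu _ _) -Ed => -[?|?]; blra.
  suff /negP : ~~ (p < d < q) by apply.
  apply: (@uncut (gamma T b)).
    by rewrite !inE map_f ?mem_enum ?orbT.
  split; first by blra.
  by exists n; [rewrite Ed|move=> j; exact: avoids_open].
move=> z zpq; have zn : gamma T a <= iter n T z < mu T a by rewrite rn//; blra.
have pn : gamma T a <= iter n T p < mu T a by rewrite ap.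
by rewrite !iterS (iet_mapE zn) (iet_mapE pn) rn//; lra.
Qed.

(** An image that meets the semi-interval without being contained in it has [u] or [v] strictly
    inside, and the preimage of that end is a cut. *)
Let returns_step n : rigid n.+1 -> (forall k, (0 < k <= n)%N -> avoids k) ->
  avoids n.+1 \/ forall z, p <= z < q -> u <= iter n.+1 T z < v.
Proof.
move=> rn av; have [|/existsNP[y /not_implyP[ypq /negP/negPn yuv]]] := pselect (avoids n.+1).
  by left.
right; have no_target t : t = u \/ t = v ->
    ~ (iter n.+1 T p < t < iter n.+1 T p + (q - p)).
  move=> tuv tT; set d := p + (t - iter n.+1 T p).
  have dpq : p < d < q by rewrite /d; blra.
  have dpq' : p <= d < q by blra.
  have Ed : iter n.+1 T d = t by rewrite rn// /d; blra.
  suff /negP : ~~ (p < d < q) by apply.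
  apply: (@uncut t).
    by rewrite !inE; case: tuv => ->; rewrite eqxx ?orbT.
  split; first by blra.
  (* At time [n.+1] itself the orbit is at [u] or [v], outside the open interval. *)
  exists n.+1 => // j; rewrite [(j <= _)%N]leq_eqVlt => /andP[j0 /predU1P[->|jn]].
    by rewrite Ed; case: tuv => ->; rewrite ltxx ?andbF.
  by apply: (avoids_open av) => //; rewrite j0.
move=> z zpq; have := no_target u (or_introl erefl).
have := no_target v (or_intror erefl).
by move: yuv; rewrite (rn z zpq) (rn y ypq); blra.
Qed.

(** Without a return all images are translates of the same interval inside the domain. Two
    overlapping images would, by injectivity, produce a return, so they are pairwise disjoint, and
    too many of them exceed the length of the domain. *)
Lemma rigid_return : exists n, [/\ (0 < n)%N,
  forall z, p <= z < q -> iter n T z = z + (iter n T p - p),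
  forall z j, p <= z < q -> (0 < j < n)%N -> ~~ (u <= iter j T z < v) &
  forall z, p <= z < q -> u <= iter n T z < v].
Proof.
apply: contrapT => nret.
have all_rigid n : rigid n /\ forall k, (0 < k <= n)%N -> avoids k.
  elim: n => [|n [rn av]].
    split=> [z _|[]//]; first by rewrite /= subrr addr0.
  have rSn := rigid_step rn av; split=> // k; rewrite [(k <= _)%N]leq_eqVlt.
  case: (returns_step rSn av) => [avS /andP[k0 /predU1P[->//|kn]]|ret].
    by apply: av; rewrite k0.
  case: nret; exists n.+1; split=> // z j zpq jn; apply: av => //.
have rig n : rigid n by have [] := all_rigid n.
have av n : (0 < n)%N -> avoids n.
  by move=> n0; have [_] := all_rigid n; apply; rewrite n0/=.
have ppq : p <= p < q by rewrite lexx.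
have dp := dom_in ppq.
have disj (i j : nat) : (i < j)%N ->
    iter i T p + (q - p) <= iter j T p \/ iter j T p + (q - p) <= iter i T p.
  move=> ij; apply: contrapT => /not_orP[/negP + /negP]; rewrite -!ltNge => h1 h2.
  have H z y : p <= z < q -> p <= y < q -> iter i T z <> iter j T y.
    move=> zpq ypq /(iter_subn_eq (dom_in zpq) (dom_in ypq) (ltnW ij)) E.
    have := av (j - i)%N; rewrite subn_gt0 => /(_ ij y ypq)/negP; apply.
    by rewrite -E; blra.
  have [ij'|ji'] := leP (iter i T p) (iter j T p).
    have zpq : p <= p + (iter j T p - iter i T p) < q by blra.
    by apply: (H _ p zpq ppq); rewrite (rig i)//; blra.
  have zpq : p <= p + (iter i T p - iter j T p) < q by blra.
  by apply: (H p _ ppq zpq); rewrite (rig j)//; blra.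
have inside k : iter k T p + (q - p) <= rend T.
  have := dom_iter k dp; rewrite /dom => /andP[_ h]; rewrite leNgt; apply/negP => h'.
  have zpq : p <= p + (rend T - iter k T p) < q by blra.
  have := dom_iter k (dom_in zpq); rewrite (rig k)// /dom; blra.
have [N] : exists N : nat, (rend T - lend T) / (q - p) < N%:R.
  by exists (Num.bound ((rend T - lend T) / (q - p))); rewrite archi_boundP// divr_ge0//; blra.
rewrite ltr_pdivrMr ?subr_gt0//; apply/negP; rewrite -leNgt.
have := @apart_packing _ _ (fun i : 'I_N => iter i T p) (fun=> q - p) _ xpredT
  (lend T) (rend T).
rewrite sumr_const card_ord -[_ *+ N]mulr_natl; apply.
- by move=> _; rewrite subr_gt0.
- by have := dp; rewrite /dom; blra.
- move=> i j ij; have [lij|lji|/val_inj eij] := ltngtP i j.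
  + exact: disj.
  + by have [] := disj _ _ lji; [right|left].
  + by rewrite eij eqxx in ij.
- by move=> i _; have /andP[? _] := dom_iter i dp; split.
Qed.

End Interval.

(** There are finitely many targets, and each has at most one cut. *)
Lemma finite_cuts : finite_set [set d | exists2 t, t \in cut_targets & cut t d].
Proof.
have -> : [set d | exists2 t, t \in cut_targets & cut t d] =
    \bigcup_(t in [set` cut_targets]) cut t by [].
apply: bigcup_finite => // t _.
have [[d dt]|nd] := pselect (exists d, cut t d).
  apply: (@sub_finite_set _ _ [set d]) => // e et /=; exact: cut_uniq et dt.
by rewrite (_ : cut t = set0)//; apply/seteqP; split=> // d dt; case: nd; exists d.
Qed.

End Return.

(** * Neighbours in a finite list of reals, and bounded return times *)

Lemma seq_max_le (R : realType) (s : seq R) u x : u \in s -> u <= x ->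
  exists2 p, p \in s & p <= x /\ forall d, d \in s -> d <= x -> d <= p.
Proof.
elim: s u => // b s IHs u; rewrite inE => /predU1P us ux.
have [[w ws wx]|nw] := pselect (exists2 w, w \in s & w <= x).
  have [p ps [px pmax]] := IHs w ws wx.
  have [bp|pb] := leP b p.
    exists p; first by rewrite inE ps orbT.
    by split=> // d; rewrite inE => /predU1P[->//|]; exact: pmax.
  have [bx|xb] := leP b x.
    exists b; first by rewrite mem_head.
    by split=> // d; rewrite inE => /predU1P[->//|/pmax h /h /le_lt_trans/(_ pb)/ltW].
  exists p; first by rewrite inE ps orbT.
  by split=> // d; rewrite inE => /predU1P[->|]; [rewrite leNgt xb|exact: pmax].
case: us => [ub|us]; last by case: nw; exists u.
exists b; first by rewrite mem_head.
rewrite -ub; split=> // d; rewrite inE => /predU1P[->//|ds dx].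
by case: nw; exists d.
Qed.

Lemma seq_min_gt (R : realType) (s : seq R) v x : v \in s -> x < v ->
  exists2 q, q \in s & x < q /\ forall d, d \in s -> x < d -> q <= d.
Proof.
elim: s v => // b s IHs v; rewrite inE => /predU1P vs xv.
have [[w ws xw]|nw] := pselect (exists2 w, w \in s & x < w).
  have [q qs [xq qmin]] := IHs w ws xw.
  have [qb|bq] := leP q b.
    exists q; first by rewrite inE qs orbT.
    by split=> // d; rewrite inE => /predU1P[->//|]; exact: qmin.
  have [xb|bx] := ltP x b.
    exists b; first by rewrite mem_head.
    by split=> // d; rewrite inE => /predU1P[->//|/qmin h /h /(lt_le_trans bq)/ltW].
  exists q; first by rewrite inE qs orbT.
  by split=> // d; rewrite inE => /predU1P[->|]; [rewrite ltNge bx|exact: qmin].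
case: vs => [vb|vs]; last by case: nw; exists v.
exists b; first by rewrite mem_head.
rewrite -vb; split=> // d; rewrite inE => /predU1P[->//|ds dx].
by case: nw; exists d.
Qed.

(** Each [z] lies between two consecutive elements of the list made of [u], [v] and the cuts, where
    a common return time exists; the bound is the maximum over all pairs of list elements. *)
Lemma bounded_return (R : realType) (A : finType) (T : iet R A) u v :
  lend T <= u -> v <= rend T -> exists N, forall z, u <= z < v ->
  exists2 m, (0 < m <= N)%N & u <= iter m T z < v.
Proof.
move=> lu vr; have /finite_seqP[s0 Es0] := finite_cuts lu vr.
set s := u :: v :: s0.
(* Pairs without a common return time satisfy the implication vacuously and may get the value 0. *)
have /choice[f Hf] : forall pq : R * R, exists m, (exists2 m, (0 < m)%N &
    forall z, pq.1 <= z < pq.2 -> u <= iter m T z < v) -> (0 < m)%N /\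
    forall z, pq.1 <= z < pq.2 -> u <= iter m T z < v.
  move=> pq; have [[m m0 H]|] := pselect (exists2 m, (0 < m)%N &
    forall z, pq.1 <= z < pq.2 -> u <= iter m T z < v); first by exists m.
  by exists 0%N.
exists (\max_(pq <- [seq (x, y) | x <- s, y <- s]) f pq)%N => z /andP[uz zv].
have [p ps [pz pmax]] := @seq_max_le _ s u z (mem_head _ _) uz.
have vs : v \in s by rewrite !inE eqxx orbT.
have [q qs [zq qmin]] := @seq_min_gt _ s v z vs zv.
have [||||||n [n0 _ _ ret]] := @rigid_return _ _ T u v _ _ p q => //.
- exact: pmax (mem_head _ _) uz.
- exact: le_lt_trans zq.
- exact: qmin.
- move=> t d tt dc; have ds : d \in s.
    have : [set` s0] d by rewrite -Es0; exists t.
    by rewrite /= !inE => ->; rewrite !orbT.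
  apply/negP => /andP[pd dq]; have [dz|zd] := leP d z.
    by have := pmax d ds dz; rewrite leNgt pd.
  by have := qmin d ds zd; rewrite leNgt dq.
have [|f0 fret] := Hf (p, q); first by exists n.
exists (f (p, q)); last by apply: fret; rewrite /= pz.
have pqs : (p, q) \in [seq (x, y) | x <- s, y <- s] by exact: allpairs_f.
by rewrite f0/=; exact: (@leq_bigmax_seq _ _ xpredT f).
Qed.

(** * Minimality of regular interval exchanges *)

Section LocallyConstant.
Context {R : realType}.
Implicit Types (P Q : R -> Prop) (s z a b : R).

(* [s] is [1] or [-1], according to the side of [z] that is considered. *)
Definition side_constant s P z : Prop :=
  exists2 e, 0 < e & forall d, 0 <= d < e -> (P (z + s * d) <-> P z).

Lemma side_constant_or s P Q z : side_constant s P z -> side_constant s Q z ->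
  side_constant s (fun y => P y \/ Q y) z.
Proof.
move=> [e e0 Pe] [f f0 Qf]; exists (Num.min e f); first by rewrite lt_min e0.
move=> d; rewrite lt_min => /and3P[d0 de df].
by rewrite Pe ?Qf ?d0.
Qed.

Lemma side_constant_itv_right u v z :
  side_constant 1 (fun y => u <= y < v) z.
Proof.
have [vz|zv] := leP v z.
  by exists 1 => // d d01; split=> ?; lra.
have [uz|zu] := leP u z.
  by exists (v - z); [lra|move=> d dv; split=> ?; lra].
by exists (u - z); [lra|move=> d dv; split=> ?; lra].
Qed.

Lemma side_constant_itv_left u v z : z != u -> z != v ->
  side_constant (-1) (fun y => u <= y < v) z.
Proof.
rewrite !neq_lt => /orP zu /orP zv.
have [vz|zv'] := leP v z.
  by exists (z - v); [case: zv; lra|move=> d dv; split=> ?; lra].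
have [uz|zu'] := leP u z.
  by exists (z - u); [case: zu; lra|move=> d dv; split=> ?; lra].
by exists 1 => // d d01; split=> ?; lra.
Qed.

(** Connectedness: let [S] collect the points up to which [P] agrees with [P z]. Constancy on the
    left carries the agreement to [sup S], constancy on the right carries it beyond unless [w] is
    reached. *)
Lemma locally_constant_const P a b :
  (forall z, a <= z < b -> side_constant 1 P z) ->
  (forall z, a < z < b -> side_constant (-1) P z) ->
  forall z w, a <= z < b -> a <= w < b -> (P z <-> P w).
Proof.
move=> Pr Pl z w; wlog zw : z w / z <= w.
  move=> H zab wab; have [|/ltW] := leP z w; first by move=> /H; apply.
  by move=> /H - /(_ wab zab)[? ?]; split.
move=> zab wab; pose S := [set t | z <= t <= w /\
  forall s, z <= s <= t -> (P s <-> P z)].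
have Sz : S z.
  by split=> [|s ?]; [rewrite lexx|have -> : s = z by lra].
have hS : has_sup S by split; [exists z|exists w => t [/andP[]]].
have zp : z <= sup S by apply: sup_upper_bound.
have pw : sup S <= w by apply: sup_le_ub; [exists z|move=> t [/andP[]]].
have lt_p s : z <= s < sup S -> (P s <-> P z).
  move=> /andP[zs sp]; have e0 : 0 < sup S - s by rewrite subr_gt0.
  have [t [_ tS] st] := sup_adherent e0 hS.
  by apply: tS; rewrite zs/=; lra.
have Pp : P (sup S) <-> P z.
  have [<-//|zp'] := eqVneq z (sup S).
  have {}zp' : z < sup S by rewrite lt_neqAle zp'.
  have [|e e0 Pe] := Pl (sup S); first by lra.
  have [d [d0 de dz]] : exists d, [/\ 0 < d, d < e & d <= sup S - z].
    exists (Num.min (e / 2) (sup S - z)).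
    by rewrite lt_min gt_min ge_min lexx orbT; split=> //; lra.
  rewrite -(Pe d); last by lra.
  by apply: lt_p; lra.
have [<-//|pw'] := eqVneq (sup S) w; first by rewrite Pp.
have {}pw' : sup S < w by rewrite lt_neqAle pw'.
have [|e e0 Pe] := Pr (sup S); first by lra.
have [d [d0 de dw]] : exists d, [/\ 0 < d, d < e & d <= w - sup S].
  exists (Num.min (e / 2) (w - sup S)).
  by rewrite lt_min gt_min ge_min lexx orbT; split=> //; lra.
have : S (sup S + d).
  split=> [|s szd]; first by lra.
  have [sp|ps] := ltP s (sup S); first by apply: lt_p; lra.
  by rewrite -Pp -(Pe (s - sup S)) ?mul1r ?subrKC//; lra.
by move=> /(sup_upper_bound hS); lra.
Qed.

End LocallyConstant.

(** Pigeonhole: an orbit that never meets [G] stays in the finite set [B] and must repeat. *)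
Lemma finite_escape (X : Type) (B : set X) (f : X -> X) (G : X -> Prop) x :
  finite_set B -> B x -> (forall y, B y -> ~ G y -> B (f y)) ->
  (exists n, G (iter n f x) /\ B (iter n f x)) \/
  exists m n, (m < n)%N /\ iter m f x = iter n f x.
Proof.
move=> Bfin Bx Bf; apply: contrapT => /not_orP[nG nP].
have Bn n : B (iter n f x).
  by elim: n => //= n Bn; apply: Bf => // Gn; apply: nG; exists n.
apply: infinite_nat; have -> : [set: nat] = (fun n => iter n f x) @^-1` B.
  by apply/seteqP; split=> // n _; exact: Bn.
apply: finite_preimage => // m n _ _ E.
by have [mn|nm|//] := ltngtP m n; case: nP; [exists m, n|exists n, m].
Qed.

(** * Absence of connections and of periodic points *)

Section Regular.
Context {R : realType} {A : finType}.
Implicit Types (T : iet R A) (a b c : A) (z w u v : R).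

Lemma lend_lt_gamma T a : not_first T a -> lend T < gamma T a.
Proof.
move=> [b /mu_le_gamma]; apply: lt_le_trans.
exact: le_lt_trans (lend_le_gamma T b) (gamma_lt_mu T b).
Qed.

Lemma gamma_first T a : ~ not_first T a -> gamma T a = lend T.
Proof.
move=> na; rewrite /gamma big_pred0 ?addr0// => b; apply/negP => ba.
by apply: na; exists b.
Qed.

Lemma gamma_inj T : injective (gamma T).
Proof.
move=> a b ab; apply: (@exchanged_uniq _ _ T _ _ (gamma T a)).
  by rewrite lexx gamma_lt_mu.
by rewrite ab lexx gamma_lt_mu.
Qed.

(** Expresses membership in a two-sided orbit by forward iterates only. *)
Lemma orbitP T z w : dom T z -> Defs.orbit T z w ->
  dom T w /\ exists m n, iter m T z = iter n T w.
Proof.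
move=> dz [[n|n] _ <-] /=.
  by split; [exact: dom_iter|exists n, 0%N].
have -> : iet_inv T (iter n (iet_inv T) z) = iter n.+1 (swap T) z.
  by rewrite -iterS iter_iet_inv.
split; first exact: (@dom_iter _ _ (swap T)).
by exists 0%N, n.+1; rewrite iterK_swap.
Qed.

Lemma iter_orbit T n z : Defs.orbit T z (iter n T z).
Proof. by exists n%:Z. Qed.

Lemma orbit_map T z w : dom T z -> Defs.orbit T z w -> Defs.orbit T z (T w).
Proof.
move=> dz [[n|n] _ <-]; first by exists n.+1%:Z.
exists (- n%:Z) => //; rewrite iet_pow_neg// /iet_pow iter_iet_inv// iterS mapK_swap//.
exact: (@dom_iter _ _ (swap T)).
Qed.

Lemma periodic_orbit T n z : dom T z -> (0 < n)%N -> iter n T z = z ->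
  finite_set (Defs.orbit T z).
Proof.
move=> dz n0 nz.
apply: (@sub_finite_set _ _ [set iter k T z | k in `I_n]); last first.
  by apply: finite_image; exact: finite_II.
have fwd w : [set iter k T z | k in `I_n] w -> [set iter k T z | k in `I_n] (T w).
  move=> [k /= kn <-]; have [kn'|] := ltnP k.+1 n; first by exists k.+1.
  move=> nk; exists 0%N => //=; rewrite -iterS.
  by have -> : k.+1 = n by apply/eqP; rewrite eqn_leq kn.
have bwd w : [set iter k T z | k in `I_n] w ->
    [set iter k T z | k in `I_n] (iet_inv T w).
  move=> [[|k] /= kn <-].
    exists n.-1 => /=; first by rewrite prednK.
    rewrite -[in RHS]nz -(prednK n0) iterS iet_invE ?swapK//.
      exact: dom_iter.
    by apply: dom_map; exact: dom_iter.
  exists k => /=; first exact: ltnW.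
  rewrite /= iet_invE ?swapK//; first exact: dom_iter.
  by apply: dom_map; exact: dom_iter.
have z0 : [set iter k T z | k in `I_n] z by exists 0%N.
move=> _ [[m|m] _ <-]; last first.
  by rewrite /iet_pow; elim: m.+1 => //= j; exact: bwd.
by rewrite /iet_pow; elim: m => //= j; exact: fwd.
Qed.

Lemma orbit_meet T m n a b : regular T -> not_first T a -> not_first T b ->
  iter m T (gamma T a) = iter n T (gamma T b) -> a = b.
Proof.
move=> [_ triv] na nb E; apply: triv => //.
by exists (iter m T (gamma T a)); split; [|rewrite E]; exact: iter_orbit.
Qed.

(** The semi-interval that is first in the second order is sent to the left end; [a] ensures that
    the alphabet is nonempty. *)
Lemma lend_image T a : exists b, T (gamma T b) = lend T.
Proof.
have dl : dom (swap T) (lend T).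
  have /andP[_ ar] := dom_gamma T a.
  by rewrite dom_swap /dom lexx (le_lt_trans (lend_le_gamma T a)).
have [b /andP[bl _]] := in_exchanged dl; exists b.
by rewrite iet_map_gamma; apply/le_anti; rewrite bl (lend_le_gamma (swap T)).
Qed.

(** For [b] not first, disjointness of orbits forces [a = b], and infiniteness forces [n = 0]. For
    [b] first, its left endpoint is the image of some [gamma T c], which reduces to [c] and [n.+1],
    unless [c] is first too and the left end is fixed. *)
Lemma no_connection T n a b : regular T -> not_first T a ->
  iter n T (gamma T b) = gamma T a -> n = 0%N.
Proof.
move=> reg na; wlog nb : n b / not_first T b.
  move=> H E; have [nb|/gamma_first fb] := pselect (not_first T b); first exact: H E.
  have [c Tc] := lend_image T a.
  have [nc|/gamma_first fc] := pselect (not_first T c).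
    by have := H n.+1 c nc; rewrite iterSr Tc -fb E => /(_ erefl).
  have := lend_lt_gamma na; rewrite -E fb => /lt_eqF/eqP; case.
  by elim: n {E H} => //= n <-; rewrite -{1}Tc fc.
move=> E; have ab : a = b by apply: (@orbit_meet T 0 n) => //; rewrite E.
case: n E => // n E; have [inf _] := reg; case: (inf b nb).
by apply: (@periodic_orbit T n.+1); rewrite ?dom_gamma// E ab.
Qed.

Lemma iter_periodic T n p m : iter n T p = p -> iter m T p = iter (m %% n) T p.
Proof.
move=> np; rewrite [in LHS](divn_eq m n) addnC iterD; congr (iter _ _ _).
by elim: (m %/ n)%N => //= k IHk; rewrite mulSn iterD IHk.
Qed.

(** The letter [c] excludes the one-letter alphabet, whose exchange is the identity. *)
Lemma aperiodic T n p c : regular T -> not_first T c -> dom T p -> (0 < n)%N ->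
  iter n T p <> p.
Proof.
move=> reg nc dp n0 np.
(* Slide the periodic orbit to the left until it meets a separation point,
   which is then periodic. *)
have [k [a [ka kamin]]] : exists k a, gamma T a <= iter k T p /\
    forall m b, gamma T b <= iter m T p ->
      iter k T p - gamma T a <= iter m T p - gamma T b.
  have [a0 /andP[a0p _]] := in_exchanged dp.
  pose P (x : 'I_n * A) := gamma T x.2 <= iter x.1 T p.
  case: (@arg_minP _ _ _ (Ordinal n0, a0) P (fun x => iter x.1 T p - gamma T x.2)).
    exact: a0p.
  move=> [k a] /= Pk kmin; exists k, a; split=> // m b bm.
  rewrite (iter_periodic m np) in bm *.
  exact: (kmin (Ordinal (ltn_pmod m n0), b)).
(* Since the gap is minimal, each shifted iterate stays in the exchanged semi-interval of the
   original one, and both undergo the same translation. *)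
have slide j : iter j T (gamma T a) = iter (k + j) T p - (iter k T p - gamma T a).
  elim: j => [|j IHj]; first by rewrite addn0 /=; lra.
  have [b bkj] := in_exchanged (dom_iter (k + j) dp).
  have bj : gamma T b <= iter j T (gamma T a) < mu T b.
    by rewrite IHj; case/andP: bkj => /[dup]/kamin; lra.
  by rewrite addnS !iterS (iet_mapE bj) (iet_mapE bkj) IHj; lra.
have Ea : iter n T (gamma T a) = gamma T a.
  by rewrite slide iterD np; lra.
have [na|/gamma_first fa] := pselect (not_first T a).
  by move: n0; rewrite (no_connection reg na Ea).
(* The left end of the domain is now periodic; its predecessor in the cycle is the separation point
   [gamma T d] sent to it. *)
have [d Td] := lend_image T a.
have Ed : iter n.-1 T (lend T) = gamma T d.
  have dl : dom T (lend T) by rewrite -fa dom_gamma.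
  apply: (@iter_inj _ _ T 1); [exact: dom_iter|exact: dom_gamma|].
  by rewrite /= Td -iterS prednK// -fa.
have [nd|/gamma_first fd] := pselect (not_first T d).
  have n1 : n.-1 = 0%N by apply: (@no_connection T _ d a) => //; rewrite fa.
  by have := lend_lt_gamma nd; rewrite -Ed n1 ltxx.
have {d fd Td Ed} Ta : T (gamma T a) = gamma T a by rewrite fa -fd Td fd.
(* As the left end is fixed, the map is the identity up to the next separation point,
   [gamma T b]. *)
have [b nb bmin] : exists2 b, not_first T b &
    forall e, not_first T e -> gamma T b <= gamma T e.
  case: (@arg_minP _ _ _ c (fun e => `[< not_first T e >]) (gamma T)).
    exact/asboolP.
  by move=> b /asboolP nb bmin; exists b => // e /asboolP; exact: bmin.
have fixa x : lend T <= x -> x < gamma T b -> T x = x.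
  move=> lx xb; have dx : dom T x.
    by have := dom_gamma T b; rewrite /dom; lra.
  have [e ex] := in_exchanged dx.
  have [/bmin|/gamma_first fe] := pselect (not_first T e); first by lra.
  have ea : e = a by apply: (@gamma_inj T); rewrite fe fa.
  by rewrite (iet_mapE ex) ea -iet_map_gamma Ta; lra.
(* The semi-interval containing [y] begins strictly before [y], so its left endpoint is sent into
   the fixed zone and is itself fixed. Then [y] is fixed as well, and so is [gamma T b], a
   connection. *)
set y := swap T (gamma T b).
have dy : dom T y by apply: (@dom_map _ _ (swap T)); exact: dom_gamma.
have Ty : T y = gamma T b by rewrite mapK_swap ?dom_gamma.
have [d dy'] := in_exchanged dy.
have yd : gamma T d < y.
  rewrite lt_neqAle; case/andP: dy' => -> _; rewrite andbT; apply/eqP => dE.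
  by have := @no_connection T 1 b d reg nb; rewrite /= dE => /(_ Ty).
have Tdd : T (gamma T d) = gamma T d.
  apply: (@iter_inj _ _ T 1); rewrite ?dom_map ?dom_gamma//=.
  apply: fixa; first by have /andP[] := dom_map (dom_gamma T d).
  by rewrite -Ty (iet_mapE dy') iet_map_gamma; lra.
have : T y = y by rewrite (iet_mapE dy') -iet_map_gamma Tdd; lra.
rewrite Ty => yb; have := @no_connection T 1 b b reg nb; rewrite /= [in T _]yb Ty.
by move=> /(_ erefl).
Qed.

End Regular.

(** * Boundary points of invariant sets, and minimality *)

Section Minimality.
Context {R : realType} {A : finType}.
Implicit Types (T : iet R A) (P X : R -> Prop) (z w u v : R).

Lemma right_constant_preim T P z : dom T z -> side_constant 1 P (T z) ->
  side_constant 1 (fun y => P (T y)) z.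
Proof.
move=> /in_exchanged[a az] [e e0 Pe]; exists (Num.min e (mu T a - z)).
  by rewrite lt_min e0/=; lra.
move=> d; rewrite lt_min => /and3P[d0 de dz].
have ad : gamma T a <= z + 1 * d < mu T a by lra.
rewrite -(Pe d) ?d0// (iet_mapE ad) (iet_mapE az).
by rewrite (_ : _ + _ + _ * d = z + 1 * d + (gamma (swap T) a - gamma T a)); [|lra].
Qed.

Lemma left_constant_preim T P z a : gamma T a < z < mu T a ->
  side_constant (-1) P (T z) -> side_constant (-1) (fun y => P (T y)) z.
Proof.
move=> az [e e0 Pe]; exists (Num.min e (z - gamma T a)).
  by rewrite lt_min e0/=; lra.
move=> d; rewrite lt_min => /and3P[d0 de dz].
have ad : gamma T a <= z + -1 * d < mu T a by lra.
have az' : gamma T a <= z < mu T a by lra.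
rewrite -(Pe d) ?d0// (iet_mapE ad) (iet_mapE az').
by rewrite (_ : _ + _ + _ * d = z + -1 * d + (gamma (swap T) a - gamma T a)); [|lra].
Qed.

(** For the predicates used below, which are constant on the right of each point, these are the
    interior boundary points. *)
Definition left_jumps T P : set R :=
  [set z | lend T < z < rend T /\ ~ side_constant (-1) P z].

Lemma not_gamma_inside T z : dom T z -> (forall a, z <> gamma T a) ->
  exists2 a, gamma T a < z < mu T a & lend T < T z.
Proof.
move=> /in_exchanged[a az] nz; exists a.
  by rewrite lt_neqAle; case/andP: az => -> ->; rewrite !andbT; apply/eqP => /esym/nz.
rewrite (iet_mapE az) (le_lt_trans (lend_le_gamma (swap T) a))//.
have : z != gamma T a by apply/eqP/nz.
by rewrite neq_lt => /orP[]; lra.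
Qed.

Lemma left_jumps_map T P z : (forall a, z <> gamma T a) ->
  left_jumps T (fun y => P (T y)) z -> left_jumps T P (T z).
Proof.
move=> nz [zT jz]; have dz : dom T z by rewrite /dom; lra.
have [a az Tz] := not_gamma_inside dz nz.
split; first by have := dom_map dz; rewrite /dom; lra.
by move=> /(left_constant_preim az).
Qed.

(** A jump of a predicate composed with [T] is a separation point or the preimage of a jump, so
    finiteness propagates along [n]. *)
Lemma left_jumps_iter T u v n :
  finite_set (left_jumps T (fun z => u <= iter n T z < v)) /\
  forall z, dom T z -> side_constant 1 (fun z => u <= iter n T z < v) z.
Proof.
elim: n => [|n [fin rc]].
  split; last by move=> z _; exact: side_constant_itv_right.
  apply: (@sub_finite_set _ _ [set u; v]) => //= z [_ nz].
  have [->|zu] := eqVneq z u; first by left.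
  have [->|zv] := eqVneq z v; first by right.
  by case: nz; exact: side_constant_itv_left.
have E : (fun z => u <= iter n.+1 T z < v) = (fun z => u <= iter n T (T z) < v).
  by apply/funext => z; rewrite iterSr.
split; last first.
  move=> z dz; have := right_constant_preim dz (rc _ (dom_map dz)).
  by under [in X in _ -> X]eq_fun do rewrite iterSr.
apply: (@sub_finite_set _ _ (range (gamma T) `|`
  swap T @` left_jumps T (fun z => u <= iter n T z < v))); last first.
  by rewrite finite_setU; split; exact: finite_image.
move=> z jz; have [[a az]|nz] := pselect (exists a, z = gamma T a).
  by left; exists a.
have dz : dom T z by case: jz => ? _; rewrite /dom; lra.
right; exists (T z); last by rewrite swapK.
apply: left_jumps_map; first by move=> a az; apply: nz; exists a.
by case: jz => ? jz; split=> // h; apply: jz; under eq_fun do rewrite iterSr.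
Qed.

Lemma left_jumps_visits T u v N :
  finite_set (left_jumps T (fun z => exists2 n, (n < N)%N & u <= iter n T z < v)) /\
  forall z, dom T z ->
    side_constant 1 (fun z => exists2 n, (n < N)%N & u <= iter n T z < v) z.
Proof.
elim: N => [|N [fin rc]].
  have none s z : side_constant s (fun z => exists2 n, (n < 0)%N & u <= iter n T z < v) z.
    by exists 1 => // d _; split=> -[].
  split=> [|z _]; last exact: none.
  by apply: (@sub_finite_set _ _ set0) => // z [_]; case; exact: none.
have E : (fun z => exists2 n, (n < N.+1)%N & u <= iter n T z < v) =
    (fun z => (exists2 n, (n < N)%N & u <= iter n T z < v) \/ u <= iter N T z < v).
  apply/funext => z; apply/propext; split=> [[n]|[[n nN nz]|Nz]].
  - rewrite ltnS leq_eqVlt => /predU1P[->|nN] nz; first by right.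
    by left; exists n.
  - by exists n => //; exact: ltnW.
  - by exists N.
have [finN rcN] := left_jumps_iter T u v N.
rewrite E; split=> [|z dz]; last by apply: side_constant_or; [exact: rc|exact: rcN].
apply: (@sub_finite_set _ _ (left_jumps T
    (fun z => exists2 n, (n < N)%N & u <= iter n T z < v) `|`
  left_jumps T (fun z => u <= iter N T z < v))); last by rewrite finite_setU.
move=> z [zT jz]; apply: contrapT => /not_orP[nj njN]; apply: jz.
by apply: side_constant_or; apply: contrapT => h; [apply: nj|apply: njN].
Qed.

(** The invariance holds only on the domain, hence the radius is reduced so as not to cross its left
    end. *)
Lemma left_jumps_invariant T X z : (forall y, dom T y -> (X y <-> X (T y))) ->
  (forall a, z <> gamma T a) -> left_jumps T X z -> left_jumps T X (T z).
Proof.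
move=> inv nz [zT jz]; apply: left_jumps_map => //; split=> // -[e e0 He].
apply: jz; exists (Num.min e (z - lend T)); first by rewrite lt_min e0; lra.
move=> d; rewrite lt_min => /and3P[d0 de dl].
have dz : dom T z by rewrite /dom; lra.
have dd : dom T (z + -1 * d) by rewrite /dom; lra.
by rewrite (inv _ dd) (inv _ dz) He ?d0.
Qed.

Theorem backward_visit T u v c z : regular T -> not_first T c ->
  lend T <= u -> u < v -> v <= rend T -> dom T z ->
  exists n, u <= iter n (swap T) z < v.
Proof.
move=> reg nc lu uv vr dz.
have [N1 ret1] := bounded_return lu vr.
have [N2 ret2] := @bounded_return _ _ (swap T) u v lu vr.
pose N := maxn N1 N2.
pose X y := exists2 n, (n < N)%N & u <= iter n (swap T) y < v.
have dI y : u <= y < v -> dom T y by rewrite /dom; lra.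
(* If the visit time would grow to [N], the forward return shortens it; if [T y] is visited at time
   0, the backward return supplies another visit within [N] steps. *)
have inv y : dom T y -> (X y <-> X (T y)).
  move=> dy; split=> [[n nN nI]|[[|n] nN nI]]; last 1 first.
  - by exists n; [exact: ltnW|move: nI; rewrite iterSr swapK].
  - have [nN'|Nn] := ltnP n.+1 N.
      by exists n.+1 => //; rewrite iterSr swapK.
    have [m /andP[m0 mN1] mI] := ret1 _ nI.
    have mn : (m <= n.+1)%N.
      by rewrite (leq_trans mN1)// (leq_trans _ Nn)// leq_maxl.
    exists (n.+1 - m)%N; first by rewrite (leq_trans _ nN)// ltn_subrL m0.
    have := iter_swapK (n.+1 - m) (dom_iter m (dI _ nI)).
    by rewrite -iterD subnK// iterS iterK_swap// => ->.
  - have [[|m] // /andP[_ mN2]] := ret2 _ nI.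
    rewrite iterSr/= swapK// => mI; exists m => //.
    by rewrite (leq_trans mN2)// leq_maxr.
have inv' y : dom (swap T) y -> (X y <-> X (swap T y)).
  by move=> dy; rewrite [in X (swap T y)]inv ?mapK_swap//; exact: (@dom_map _ _ (swap T)).
have [fin rc] := left_jumps_visits (swap T) u v N.
have no_jump y : ~ left_jumps T X y.
  move=> jy; have dy : dom T y by case: jy => ? _; rewrite /dom; lra.
  (* The forward orbit of a jump stays among the finitely many jumps until it
     meets a separation point, and its backward orbit until it meets the image
     of one: this is a connection. *)
  have [[m [[a am] jm]]|[m [n [mn E]]]] := @finite_escape _ _ T
    (fun w => exists a, w = gamma T a) _ fin jy
    (fun w jw nw => left_jumps_invariant inv (fun a wa => nw (ex_intro _ a wa)) jw);
    last first.
    have := iter_subn_eq dy dy (ltnW mn) E; apply/nesym.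
    by apply: (aperiodic reg nc dy); rewrite subn_gt0.
  have [[n [[b bn] _]]|[n [k [nk E]]]] := @finite_escape _ _ (swap T)
    (fun w => exists a, w = gamma (swap T) a) _ fin jy
    (fun w jw nw => left_jumps_invariant inv' (fun a wa => nw (ex_intro _ a wa)) jw);
    last first.
    have Ey := @iter_subn_eq _ _ (swap T) _ _ _ _ dy dy (ltnW nk) E.
    apply: (@aperiodic _ _ T (k - n) y c) => //; first by rewrite subn_gt0.
    by rewrite [in LHS]Ey iterK_swap.
  have na : not_first T a.
    apply: contrapT => /gamma_first fa; case: jm; rewrite am fa ltxx//.
  (* The point [T (gamma T b)] reaches [y] after [n] steps, and [y] reaches [gamma T a] after [m]
     more. *)
  have := @no_connection _ _ T (m + n).+1 a b reg na.
  rewrite iterSr iet_map_gamma -bn iterD iterK_swap// am => /(_ erefl) //.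
have Xu : X u.
  have [|m /andP[m0 mN1] _] := ret1 u; first by rewrite lexx.
  exists 0%N; last by rewrite /= lexx.
  exact: leq_trans m0 (leq_trans mN1 (leq_maxl _ _)).
suff [n _ nz] : X z by exists n.
apply/(@locally_constant_const _ X (lend T) (rend T) _ _ z u) => //.
- by move=> y yT; apply: contrapT => jy; apply: (no_jump y).
- by rewrite lu (lt_le_trans uv vr).
Qed.

End Minimality.

(** * The induced transformation *)

(** The two orders on letters are those of the left endpoints in the two tilings; [tiling_start]
    recovers these endpoints from the lengths. *)
Lemma iet_of_tilings (R : realType) (A : finType) (x y l : A -> R) (u v : R) :
  (forall a, 0 < l a) -> \sum_a l a = v - u ->
  apart x l -> (forall a, u <= x a /\ x a + l a <= v) ->
  apart y l -> (forall a, u <= y a /\ y a + l a <= v) ->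
  exists S : iet R A, [/\ lend S = u, rend S = v,
    gamma S =1 x, len S =1 l & gamma (swap S) =1 y].
Proof.
move=> l0 total xapt xin yapt yin.
have inj f : apart f l -> injective f.
  move=> fapt a b fab; apply/eqP; apply: contraT => /fapt; rewrite fab.
  by have := l0 a; have := l0 b => ? ? [?|?]; lra.
have order f : apart f l -> total_order (fun a b => f a <= f b).
  move=> fapt; split=> [a b|a b /le_anti /(inj f fapt)//|b a c]; first exact: le_total.
  exact: le_trans.
exists (Iet (order x xapt) (order y yapt) u l0).
have start f (fapt : apart f l) a : (forall b, u <= f b /\ f b + l b <= v) ->
    u + \sum_(b | (b != a) && (f b <= f a)) l b = f a.
  move=> fin; rewrite [RHS](tiling_start l0 fapt fin total); congr (_ + _).
  by apply: eq_bigl => b; rewrite lt_neqAle (inj_eq (inj f fapt)).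
split=> //= [|a|a]; [|exact: start|exact: start].
by rewrite /rend /= total subrKC.
Qed.

Lemma min_natP (P : set nat) : match min_nat P with
  | Some n => P n /\ forall m, P m -> (n <= m)%N
  | None => forall n, ~ P n end.
Proof.
rewrite /min_nat; case: pselect => [exP|nP n Pn]; last first.
  by apply: nP; exists n; apply/asboolP.
by case: ex_minnP => n /asboolP Pn nmin; split=> // m /asboolP; exact: nmin.
Qed.

Lemma induced_iter (R : realType) (f : R -> R) (I : set R) z n : (0 < n)%N ->
  I (iter n f z) -> (forall j, (0 < j < n)%N -> ~ I (iter j f z)) ->
  induced f I z = Some (iter n f z).
Proof.
move=> n0 In nI; rewrite /induced.
have := min_natP [set n | (0 < n)%N /\ I (iter n f z)].
case: min_nat => [m [[m0 Im] mmin]|/(_ n)]; last by case.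
congr (Some (iter _ f z)); apply/eqP; rewrite eqn_leq mmin//=.
by rewrite leqNgt; apply/negP => mn; apply: (nI m) => //; rewrite m0.
Qed.

(** * Division points as first backward visits *)

Section Division.
Context {R : realType} {A : finType}.
Variables (T : iet R A) (u v : R).
Implicit Types (a b : A) (w d : R).

(** Removes the integers and the infinite bounds: exponents [k >= 0] give the first alternative,
    where the end point [w] itself must avoid the open interval if [k > 0]; exponents [k <= 0] give
    the second, where [w] may lie in it. *)
Lemma N_setP a w : N_set u v T (gamma T a) w <-> dom T w /\
  exists k, (iter k T (gamma T a) = w /\
      forall j, (0 < j <= k)%N -> ~~ (u < iter j T (gamma T a) < v)) \/
    (iter k T w = gamma T a /\
      forall j, (0 < j <= k)%N -> ~~ (u < iter j T w < v)).
Proof.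
set g := gamma T a; have dg : dom T g := dom_gamma T a.
have plus : match rho_plus u v T g with
    | Some n => [/\ (0 < n)%N, u < iter n T g < v &
        forall m, (0 < m)%N -> u < iter m T g < v -> (n <= m)%N]
    | None => forall m, (0 < m)%N -> ~ u < iter m T g < v end.
  rewrite /rho_plus; have := min_natP [set n | (0 < n)%N /\ iet_pow T n%:Z g \in `]u, v[].
  case: min_nat => [n [[n0 ng] nmin]|nP m m0 mg].
    split=> // m m0 mg.
    by apply: nmin; rewrite /= in_itv.
  by apply: (nP m); rewrite /= in_itv.
have minus : match rho_minus u v T g with
    | Some n => u < iter n (swap T) g < v /\
        forall m, u < iter m (swap T) g < v -> (n <= m)%N
    | None => forall m, ~ u < iter m (swap T) g < v end.
  rewrite /rho_minus; have := min_natP [set n | iet_pow T (- n%:Z) g \in `]u, v[].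
  case: min_nat => [n [ng nmin]|nP m mg].
    split=> [|m mg]; first by move: ng; rewrite /= iet_pow_neg ?in_itv.
    by apply: nmin; rewrite /= iet_pow_neg ?in_itv.
  by apply: (nP m); rewrite /= iet_pow_neg ?in_itv.
split=> [[[n|n] [kminus kplus] <-]|[dw [k [[kw kP]|[kw kP]]]]].
- split; first exact: dom_iter.
  exists n; left; split=> // j /andP[j0 jn]; apply/negP => jI.
  case: (rho_plus _ _ _ _) plus kplus => [m [_ _ /(_ j j0 jI) mj] nm|/(_ j j0)//].
  by move: nm; rewrite ltz_nat ltnNge (leq_trans mj jn).
- have -> : iet_pow T (Negz n) g = iter n.+1 (swap T) g by rewrite /iet_pow iter_iet_inv.
  split; first exact: (@dom_iter _ _ (swap T)).
  exists n.+1; right; split; first by rewrite iterK_swap.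
  move=> j /andP[j0 jn]; apply/negP.
  have -> : iter j T (iter n.+1 (swap T) g) = iter (n.+1 - j) (swap T) g.
    rewrite -{1}(subnKC jn) iterD iterK_swap//; exact: (@dom_iter _ _ (swap T)).
  move=> jI; case: (rho_minus _ _ _ _) minus kminus => [m [_ /(_ _ jI) mj] mn|/(_ _ jI)//].
  by move: mn; rewrite NegzE; lia.
- exists k%:Z => //; split.
    by case: (rho_minus _ _ _ _) => // m; lia.
  case: (rho_plus _ _ _ _) plus => // m [m0 mI _]; rewrite ltz_nat ltnNge.
  by apply/negP => mk; have := kP m; rewrite m0 mk mI => /(_ isT).
- exists (- k%:Z); last by rewrite iet_pow_neg// -kw iter_swapK.
  split; last by case: (rho_plus _ _ _ _) plus => // m [m0 _ _]; lia.
  case: (rho_minus _ _ _ _) minus => // m [mI _]; rewrite lerN2 lez_nat leqNgt.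
  apply/negP => mk; have := kP (k - m)%N; rewrite subn_gt0 mk leq_subr => /(_ isT).
  have <- : iter m (swap T) g = iter (k - m) T w; last by rewrite mI.
  rewrite -kw -{1}(subnKC (ltnW mk)) iterD iter_swapK//; exact: dom_iter.
Qed.

Hypotheses (lu : lend T <= u) (vr : v <= rend T).

(** A point of the open interval reached forward at a positive time would itself be a forbidden
    visit, so only backward iterates remain. *)
Lemma Div_cut w : u < w < v -> Div u v T w <-> exists a, cut T u v (gamma T a) w.
Proof.
move=> uwv; split=> [[a _ /N_setP[dw [[|k] [[kw kP]|[kw kP]]]]]|[a [_ [n nw nP]]]].
- by exists a; split=> //; exists 0%N => // j; case: j.
- by exists a; split=> //; exists 0%N.
- by have := kP k.+1; rewrite leqnn kw uwv => /(_ isT).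
- by exists a; split=> //; exists k.+1.
- exists a => //; apply/N_setP; split; last by exists n; right.
  by move: lu vr; rewrite /dom; lra.
Qed.

(** Splices the orbit from [d] to [w] with the one joining [w] and [gamma T a]. If [d] came strictly
    after [gamma T a], it would be a forbidden visit on the way to [w]. With admissibility, the
    targets [u] and [v] thus add no cut. *)
Lemma cut_Div w d : Div u v T w -> cut T u v w d ->
  exists a, cut T u v (gamma T a) d.
Proof.
move=> [a _ /N_setP[dw [k kw]]] [duv [n nd nP]]; exists a; split=> //.
have dd : dom T d by move: lu vr; rewrite /dom; lra.
case: kw => -[kw kP].
  have [kn|nk] := leqP k n.
    exists (n - k)%N; last by move=> j /andP[j0 jn]; apply: nP; lia.
    by apply/esym/iter_subn_eq; rewrite ?dom_gamma// kw.
  have Ed : d = iter (k - n) T (gamma T a).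
    by apply: iter_subn_eq; rewrite ?dom_gamma ?(ltnW nk)// kw.
  by have := kP (k - n)%N; rewrite subn_gt0 nk leq_subr -Ed duv => /(_ isT).
exists (k + n)%N; first by rewrite iterD nd.
move=> j /andP[j0 jkn]; have [jn|nj] := leqP j n; first by apply: nP; rewrite j0.
by rewrite -(subnK (ltnW nj)) iterD nd; apply: kP; lia.
Qed.

(** A first letter sits at the left end, which is the image of some [gamma T b]; the orbit of [d]
    passes there one step earlier. If [b] is first too, the left end is fixed and [d] would equal
    it, although [d > u]. *)
Lemma cut_not_first a d : cut T u v (gamma T a) d ->
  exists2 b, not_first T b & cut T u v (gamma T b) d.
Proof.
move=> ca; have [na|/gamma_first fa] := pselect (not_first T a); first by exists a.
have [duv [n nd nP]] := ca.
have dd : dom T d by move: lu vr; rewrite /dom; lra.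
have ld : lend T < d by move: lu; lra.
case: n nd nP => [nd|n nd nP]; first by move: ld; rewrite -fa -nd ltxx.
have [b Tb] := lend_image T a.
have nb' : iter n T d = gamma T b.
  by apply: (@iter_inj _ _ T 1); rewrite ?dom_iter ?dom_gamma//= Tb -fa -nd.
have [nb|/gamma_first fb] := pselect (not_first T b).
  exists b => //; split=> //; exists n => // j /andP[j0 jn].
  by apply: nP; rewrite j0 ltnW.
have fix_n : forall k, iter k T (lend T) = lend T.
  by elim=> //= k ->; rewrite -{1}fb.
suff dl : d = lend T by move: ld; rewrite dl ltxx.
by apply: (@iter_inj _ _ T n); rewrite -?fa ?dom_gamma// nb' fa fix_n.
Qed.

Lemma exists_cut a : u < v -> regular T -> not_first T a ->
  exists d, cut T u v (gamma T a) d.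
Proof.
(* The right half of the interval is used so that the visit avoids the end [u]. *)
move=> uv reg na; have [||n nI] := @backward_visit _ _ T ((u + v) / 2) v a
  (gamma T a) reg na _ _ vr (dom_gamma T a).
- by move: lu; lra.
- by lra.
have exn : exists n, u < iter n (swap T) (gamma T a) < v by exists n; lra.
case: (ex_minnP exn) => k kI kmin.
exists (iter k (swap T) (gamma T a)); split=> //.
exists k; first by rewrite iterK_swap// dom_gamma.
move=> j /andP[j0 jk]; apply/negP.
have -> : iter j T (iter k (swap T) (gamma T a)) = iter (k - j) (swap T) (gamma T a).
  rewrite -{1}(subnKC jk) iterD iterK_swap//.
  by apply: (@dom_iter _ _ (swap T)); exact: dom_gamma.
by move=> /kmin; lia.
Qed.

End Division.

(** * The first return map as a regular interval exchange *)

Section FirstReturn.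
Context {R : realType} {A : finType}.
Variables (T : iet R A) (u v : R).
Hypotheses (lu : lend T <= u) (uv : u < v) (vr : v <= rend T).
Hypotheses (reg : regular T) (Du : Div u v T u).
Hypothesis Dv : Div u v T v \/ v = rend T.
Implicit Types (a b : A) (z w d : R).

(* These will be the separation points of the induced map. *)
Let sep_points (x : A -> R) :=
  (forall a, not_first T a -> cut T u v (gamma T a) (x a)) /\
  (forall a, ~ not_first T a -> x a = u).

Let sep_points_exist : exists x, sep_points x.
Proof.
have /choice[x xP] : forall a, exists d,
    (not_first T a -> cut T u v (gamma T a) d) /\ (~ not_first T a -> d = u).
  move=> a; have [na|na] := pselect (not_first T a); last by exists u.
  by have [d dc] := exists_cut lu vr uv reg na; exists d.
by exists x; split=> a; have [] := xP a.
Qed.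

Let exists_first : exists a, ~ not_first T a.
Proof.
have dl : dom T (lend T) by move: lu uv vr; rewrite /dom; lra.
have [a /andP[al _]] := in_exchanged dl; exists a => /lend_lt_gamma.
by rewrite ltNge al.
Qed.

(** This is where admissibility enters; when [v] is the right end of the domain, no orbit reaches
    it. *)
Let cut_target t d : t \in cut_targets T u v -> cut T u v t d ->
  exists2 b, not_first T b & cut T u v (gamma T b) d.
Proof.
rewrite !inE => /or3P[/eqP->|/eqP->|/mapP[a _ ->]]; last exact: (cut_not_first lu vr).
  by move=> /(cut_Div lu vr Du)[a]; exact: (cut_not_first lu vr).
move=> vd; case: (Dv) => [Dv'|Ev].
  by have [a] := cut_Div lu vr Dv' vd; exact: (cut_not_first lu vr).
have [duv [n nd _]] := vd.
have dd : dom T d by move: lu vr; rewrite /dom; lra.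
by have := dom_iter n dd; rewrite nd /dom Ev ltxx andbF.
Qed.

Section Points.
Variable x : A -> R.
Hypothesis xP : sep_points x.

Let x_gt a : not_first T a -> u < x a.
Proof. by case: xP => cx _ /cx[/andP[]]. Qed.

Let x_in a : u <= x a < v.
Proof.
case: xP => cx fx; have [/cx[/andP[/ltW -> ->//]]|/fx->] := pselect (not_first T a).
by rewrite lexx.
Qed.

Let x_inj : injective x.
Proof.
case: xP => cx fx; have first a b : x a = x b -> ~ not_first T a -> ~ not_first T b.
  by move=> xab /fx xa nb; have := x_gt nb; rewrite -xab xa ltxx.
move=> a b xab; have [na|na] := pselect (not_first T a); last first.
  by apply: (@gamma_inj _ _ T); rewrite !gamma_first//; exact: first na.
have nb : not_first T b by apply: contrapT => nb; exact: (first _ _ (esym xab)) na.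
have [_ [m ma _]] := cx a na; have [_ [n nb' _]] := cx b nb.
apply: (@orbit_meet _ _ T n m) => //.
by rewrite -ma -nb' -!iterD xab addnC.
Qed.

Let target_x t d : t \in cut_targets T u v -> cut T u v t d -> exists b, d = x b.
Proof.
case: xP => cx _ tt /(cut_target tt)[b nb bd]; exists b.
exact: (cut_uniq lu vr) bd (cx b nb).
Qed.

(** [y a] is the nearest point to the right of [x a] among [v] and the values of [x]. The first
    letter puts [u] among these values, so nothing is left uncovered. *)
Let next_exists : exists y : A -> R, [/\ forall a, x a < y a <= v,
  forall a b, x a < x b -> y a <= x b &
  forall z, u <= z < v -> exists a, x a <= z < y a].
Proof.
have /choice[y yP] : forall a, exists q, [/\ q \in v :: [seq x b | b <- enum A],
    x a < q & forall d, d \in v :: [seq x b | b <- enum A] -> x a < d -> q <= d].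
  move=> a; have [|q qs [aq qmin]] := @seq_min_gt _ _ v (x a) (mem_head v [seq x b | b <- enum A]).
    by have /andP[] := x_in a.
  by exists q.
have xs b : x b \in v :: [seq x b | b <- enum A].
  by rewrite inE map_f ?mem_enum ?orbT.
exists y; split=> [a|a b ab|z /andP[uz zv]].
- have [_ -> ymin] := yP a; apply: ymin; first exact: mem_head.
  by have /andP[] := x_in a.
- by have [_ _] := yP a; apply.
have [a0 na0] := exists_first.
have us : u \in [seq x b | b <- enum A].
  by have [_ fx] := xP; rewrite -(fx a0 na0) map_f ?mem_enum.
have [_ /mapP[a _ ->] [az amax]] := seq_max_le us uz.
exists a; rewrite az /= ltNge; apply/negP => yz.
have [+ xy _] := yP a; rewrite inE => /predU1P[yv|/mapP[b _ yb]].
  by move: yz; rewrite yv leNgt zv.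
have := amax (x b); rewrite map_f ?mem_enum// -yb => /(_ isT yz).
by rewrite leNgt xy.
Qed.

(** No cut lies strictly between [x a] and [y a], so [rigid_return] applies there and gives a first
    return time [n a]. The pieces and their images are two tilings of the same semi-interval with
    the same lengths. *)
Lemma first_return_iet : exists S : iet R A, [/\ lend S = u, rend S = v,
  gamma S =1 x & forall z, u <= z < v -> exists n, [/\ (0 < n)%N,
    S z = iter n T z, u <= iter n T z < v &
    forall j, (0 < j < n)%N -> ~~ (u <= iter j T z < v)]].
Proof.
have [y [xy xy_next cover]] := next_exists.
have /choice[n nP] : forall a, exists n, [/\ (0 < n)%N,
    forall z, x a <= z < y a -> iter n T z = z + (iter n T (x a) - x a),
    forall z j, x a <= z < y a -> (0 < j < n)%N -> ~~ (u <= iter j T z < v) &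
    forall z, x a <= z < y a -> u <= iter n T z < v].
  move=> a; have /andP[ua _] := x_in a; have /andP[ay yv] := xy a.
  apply: (rigid_return lu vr ua ay yv) => t d tt td.
  have [b ->] := target_x tt td; apply/negP => /andP[/xy_next yb].
  by rewrite ltNge yb.
pose l a := y a - x a; pose p a := iter (n a) T (x a).
have l0 a : 0 < l a by have /andP[] := xy a; rewrite subr_gt0.
have xin a : x a <= x a < y a by have := xy a; lra.
have xapt : apart x l.
  move=> a b ab; have : x a != x b by rewrite (inj_eq x_inj).
  by rewrite neq_lt /l => /orP[/xy_next|/xy_next]; [left|right]; lra.
have xI a : u <= x a /\ x a + l a <= v.
  by have := x_in a; have := xy a; rewrite /l; split; lra.
have pI a : u <= p a /\ p a + l a <= v.
  have [_ rig _ ret] := nP a; have /andP[up pv] := ret _ (xin a); split=> //.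
  rewrite leNgt; apply/negP => vp.
  have zI : x a <= x a + (v - p a) < y a by move: vp; rewrite /l /p; lra.
  by have := ret _ zI; rewrite rig// -/(p a); lra.
(* Cancelling [n a] steps shows that [w] reaches [z] at time [n b - n a]; if positive, this would be
   a return before [n b]. *)
have disj a b z w : x a <= z < y a -> x b <= w < y b -> (n a <= n b)%N ->
    iter (n a) T z = iter (n b) T w -> a = b.
  move=> za wb nab E; have [na0 _ _ _] := nP a; have [_ _ nret _] := nP b.
  have zI : u <= z < v by have := x_in a; have := xy a; lra.
  have dz : dom T z by move: lu vr; rewrite /dom; lra.
  have dw : dom T w.
    by have := x_in b; have := xy b; move: lu vr; rewrite /dom; lra.
  have Ez := iter_subn_eq dz dw nab E.
  have [nn|nn] := posnP (n b - n a)%N; last first.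
    by have := nret w (n b - n a)%N wb; rewrite nn -Ez zI; lia.
  apply/eqP; apply: contraT => /xapt; move: wb; rewrite -[w]/(iter 0 T w) -nn -Ez /l.
  by move=> wb; case; lra.
have papt : apart p l.
  have H a b : a != b -> p a <= p b -> p a + l a <= p b.
    move=> ab pab; rewrite leNgt; apply/negP => pba.
    have za : x a <= x a + (p b - p a) < y a by move: pba; rewrite /l; lra.
    have Ez : iter (n a) T (x a + (p b - p a)) = iter (n b) T (x b).
      by have [_ -> // _ _] := nP a; rewrite -/(p a) -/(p b); lra.
    have [nab|/ltnW nba] := leqP (n a) (n b).
      by move: ab; rewrite (disj a b _ _ za (xin b) nab Ez) eqxx.
    by move: ab; rewrite (disj b a _ _ (xin b) za nba (esym Ez)) eqxx.
  move=> a b ab; have [pab|/ltW pba] := leP (p a) (p b); first by left; exact: H.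
  by right; apply: H => //; rewrite eq_sym.
have total : \sum_a l a = v - u.
  apply/le_anti/andP; split.
    by apply: (apart_packing l0 (ltW uv) xapt) => a _.
  apply: (@covering_length _ _ x l l0) => z /cover[a za]; exists a => //.
  by rewrite /l subrKC.
have [S [Su Sv gS lS gS']] := iet_of_tilings l0 total xapt xI papt pI.
exists S; split=> // z /cover[a za]; exists (n a).
have [n0 rig nret ret] := nP a; split=> //; last 2 first.
- exact: ret.
- by move=> j; exact: nret.
have -> : S z = z + (gamma (swap S) a - gamma S a).
  by apply: iet_mapE; rewrite /mu gS lS /l subrKC.
by rewrite rig// gS gS'.
Qed.

Section Induced.
Variable S : iet R A.
Hypotheses (Su : lend S = u) (Sv : rend S = v) (gS : gamma S =1 x).
Hypothesis S_return : forall z, u <= z < v ->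
  exists2 n, (0 < n)%N & S z = iter n T z.

Let dom_S z : dom S z = (u <= z < v).
Proof. by rewrite /dom Su Sv. Qed.

Let dom_T z : dom S z -> dom T z.
Proof. by move: lu vr; rewrite dom_S /dom; lra. Qed.

Let iter_S n z : dom S z -> exists2 k, (n <= k)%N & iter n S z = iter k T z.
Proof.
move=> dz; elim: n => [|n [k nk IHn]]; first by exists 0%N.
have [|m m0 Sm] := S_return (z := iter n S z); first by rewrite -dom_S dom_iter.
by exists (m + k)%N; [lia|rewrite iterS Sm iterD -IHn].
Qed.

Let not_first_S a : not_first S a -> not_first T a.
Proof.
move=> /lend_lt_gamma; rewrite Su gS => ua; apply: contrapT => na.
by have [_ fx] := xP; move: ua; rewrite fx// ltxx.
Qed.

(** Iterates of [S] are iterates of [T]: a finite orbit of [S] contains a repetition, hence gives a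
    periodic point of [T], and meeting orbits of [S] make the orbits of two separation points of [T]
    meet. *)
Lemma induced_regular : regular S.
Proof.
have [cx _] := xP; split=> [a /not_first_S na fin|a b /not_first_S na /not_first_S nb].
  have dx : dom S (gamma S a) := dom_gamma S a.
  have [[n [[]]]|[m [n [mn E]]]] := finite_escape (G := fun=> False) fin
    (iter_orbit S 0 _) (fun w ow _ => orbit_map dx ow).
  have Ex := iter_subn_eq dx dx (ltnW mn) E.
  have [k nk Ek] := iter_S (n - m) dx.
  apply: (aperiodic reg na (dom_T dx) (n := k)); first by lia.
  by rewrite -Ek.
move=> [w [aw bw]].
have T_meet c : Defs.orbit S (gamma S c) w ->
    exists m n, iter m T (x c) = iter n T w.
  move=> /(orbitP (dom_gamma S c))[dw [m [n E]]].
  have [m' _ Em] := iter_S m (dom_gamma S c); have [n' _ En] := iter_S n dw.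
  by exists m', n'; rewrite -gS -Em -En.
have [m [n Ea]] := T_meet a aw; have [m' [n' Eb]] := T_meet b bw.
have [_ [i ia _]] := cx a na; have [_ [j jb _]] := cx b nb.
(* With these exponents both sides become the iterate of [w] of order [i + j + n + n']. *)
apply: (@orbit_meet _ _ T (j + (n' + m)) (i + (n + m'))) => //.
rewrite -ia -jb -!iterD.
rewrite (_ : (j + (n' + m) + i = (i + j + n') + m)%N); last by lia.
rewrite (_ : (i + (n + m') + j = (i + j + n) + m')%N); last by lia.
by rewrite [LHS]iterD Ea [RHS]iterD Eb -!iterD addnAC.
Qed.

(** Inside the open interval the division points are cuts, which are values of [x] by uniqueness;
    the end [u] is the value of [x] at a first letter. *)
Lemma induced_Sep : Sep S = Div u v T `&` `[u, v[%classic.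
Proof.
have [cx fx] := xP; apply/seteqP; split=> [_ [a _ <-]|w [Dw]].
  rewrite gS; split; last by rewrite /= in_itv/= x_in.
  have [/cx ca|/fx ->//] := pselect (not_first T a).
  by apply/(Div_cut lu vr); [case: ca|exists a].
rewrite /= in_itv/= => /andP[uw wv].
have [wu|wu] := eqVneq w u.
  by have [a0 /fx xa0] := exists_first; exists a0 => //; rewrite gS xa0.
have uwv : u < w < v by rewrite lt_neqAle eq_sym wu uw.
have [a /(cut_not_first lu vr)[b nb bw]] := (Div_cut lu vr uwv).1 Dw.
by exists b => //; rewrite gS; apply: (cut_uniq lu vr) bw; exact: cx.
Qed.

End Induced.
End Points.

Lemma induced_iet : exists S : iet R A,
  [/\ lend S = u, rend S = v,
      forall z, z \in `[u, v[ -> induced T `[u, v[%classic z = Some (S z),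
      regular S
    & Sep S = Div u v T `&` `[u, v[%classic].
Proof.
have [x xP] := sep_points_exist.
have [S [Su Sv gS Sret]] := first_return_iet xP.
have Sret' z : u <= z < v -> exists2 n, (0 < n)%N & S z = iter n T z.
  by move=> /Sret[n [n0 Sn _ _]]; exists n.
exists S; split=> //.
- move=> z; rewrite in_itv/= => /Sret[n [n0 -> nI nret]].
  by apply: induced_iter => // j /nret/negP.
- exact: (induced_regular xP Su Sv gS Sret').
- exact: (induced_Sep xP gS).
Qed.

End FirstReturn.

Theorem theorem3p17 (R : realType) (A : finType) (T : iet R A) (u v : R) :
  regular T -> admissible u v T ->
  exists S : iet R A,
    [/\ lend S = u, rend S = v,
        forall z, z \in `[u, v[ -> induced T `[u, v[%classic z = Some (S z),
        regular S
      & Sep S = Div u v T `&` `[u, v[%classic].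
Proof.
move=> reg [lu uv vr Du Dv]; apply: induced_iet => //.
(* The alternative [u = rend T] contradicts [u < v], so [u] is a division point. *)
by case: Du => // ur; move: uv; rewrite ur ltNge vr.
Qed.
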